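(* Let $n\in\mathbb{N}$, let $\Phi_1,\dots,\Phi_n\in\mathcal{E}(I)$ and let $\alpha_1,\dots,\alpha_n\geq 0$ be real numbers. Then $$\alpha_1\mathcal{C}_{\Phi_1}(I)+\cdots+\alpha_n\mathcal{C}_{\Phi_n}(I)\subseteq \mathcal{C}_{\alpha_1\Phi_1+\cdots+\alpha_n\Phi_n}(I),$$ i.e., if $f_i\in\mathcal{C}_{\Phi_i}(I)$ for $i=1,\dots,n$, then $\alpha_1f_1+\cdots+\alpha_nf_n\in\mathcal{C}_{\alpha_1\Phi_1+\cdots+\alpha_n\Phi_n}(I)$. In particular, for every $\Phi\in\mathcal{E}(I)$, the class $\mathcal{C}_\Phi(I)$ is convex (as a subset of the vector space of functions $I\to\mathbb{R}$).
   Context: $I\subseteq\mathbb{R}$ is a nonempty open interval and $\ell(I)\in(0,\infty]$ is its length. $\mathcal{E}(I)$ is the set of all functions $\Phi:[0,\ell(I))\to[0,\infty)$ (called error functions). For $\Phi\in\mathcal{E}(I)$, a function $f:I\to\mathbb{R}$ is called $\Phi$-convex if for all $x,y\in I$ and $t\in[0,1]$, $$f(tx+(1-t)y)\leq tf(x)+(1-t)f(y)+t\Phi((1-t)|x-y|)+(1-t)\Phi(t|x-y|).$$ $\mathcal{C}_\Phi(I)$ denotes the class of all $\Phi$-convex functions on $I$. *)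

(* Defs.v *)
From HB Require Import structures.
From mathcomp Require Import all_boot all_order all_algebra.
From mathcomp Require Import all_classical all_reals all_analysis.
From mathcomp Require Import lra.

Set Implicit Arguments.
Unset Strict Implicit.
Unset Printing Implicit Defensive.

Import Order.TTheory GRing.Theory Num.Theory.
Import numFieldNormedType.Exports.

Local Open Scope classical_set_scope.
Local Open Scope ring_scope.

Record openInterval (R : realType) := OpenInterval {
  itv_set :> set R ;
  itv_nonempty : itv_set !=set0 ;
  itv_open : open itv_set ;
  itv_interval : is_interval itv_set }.

Definition itv_length (R : realType) (I : set R) : \bar R :=
  (ereal_sup (EFin @` I) - ereal_inf (EFin @` I))%E.

Definition err_dom (R : realType) (I : set R) : set R :=
  [set u | 0 <= u /\ (u%:E < itv_length I)%E].

(* A set coerces to the subtype of its elements, so the functions below are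
   genuinely defined on I and on [0, l(I)) only. *)
Definition error_functions (R : realType) (I : openInterval R) :
    set (err_dom I -> R^o) :=
  [set Phi | forall u, 0 <= Phi u].
Arguments error_functions {R} I _.

Lemma conv_in_itv (R : realType) (I : openInterval R) (t : {i01 R}) (x y : I) :
  t%:num * val x + (1 - t%:num) * val y \in (I : set R).
Proof.
apply/mem_set.
have t0 : 0 <= t%:num by [].
have t1 : t%:num <= 1 by [].
have Ix := set_valP x; have Iy := set_valP y.
case: (leP (val x) (val y)) => [xy|/ltW yx].
  by apply: (itv_interval Ix Iy); apply/andP; split; nra.
by apply: (itv_interval Iy Ix); apply/andP; split; nra.
Qed.

Lemma dist_lt_length (R : realType) (I : openInterval R) (x y : R) :
  itv_set I x -> itv_set I y -> (`|x - y|%:E < itv_length I)%E.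
Proof.
wlog yx : x y / y <= x.
  move=> H Ix Iy; case: (leP y x) => [yx|/ltW xy]; first exact: H.
  by rewrite distrC; exact: H.
move=> Ix Iy.
have /nbhs_ballP[e /= e0 eI] := open_nbhs_nbhs (conj (@itv_open R I) Ix).
have Ixe : itv_set I (x + e / 2).
  apply: eI; rewrite /ball /= opprD addrA subrr sub0r normrN.
  by rewrite ger0_norm; [lra|rewrite divr_ge0 // ltW].
rewrite ger0_norm ?subr_ge0 //.
apply: (@lt_le_trans _ _ ((x + e / 2)%:E - y%:E)%E).
  by rewrite -EFinB lte_fin; lra.
apply: leeB; first by apply: ereal_sup_ubound; exists (x + e / 2).
by apply: ereal_inf_lbound; exists y.
Qed.

Lemma scaled_dist_in_err_dom (R : realType) (I : openInterval R)
    (t : {i01 R}) (x y : I) :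
  t%:num * `|val x - val y| \in err_dom I.
Proof.
apply/mem_set; split; first by rewrite mulr_ge0.
apply: le_lt_trans (dist_lt_length (set_valP x) (set_valP y)).
by rewrite lee_fin ler_piMl.
Qed.

Definition conv_itv (R : realType) (I : openInterval R) (t : {i01 R})
    (x y : I) : I :=
  SigSub (conv_in_itv t x y).

Definition scaled_dist (R : realType) (I : openInterval R) (t : {i01 R})
    (x y : I) : err_dom I :=
  SigSub (scaled_dist_in_err_dom t x y).

(* The codomain is R^o, which is R seen as a module over itself, so that
   functions into it form an R-module. *)
Definition Phi_convex (R : realType) (I : openInterval R)
    (Phi : err_dom I -> R^o) : set (I -> R^o) :=
  [set f | forall (x y : I) (t : {i01 R}),
    f (conv_itv t x y) <=
      t%:num * f x + (1 - t%:num) * f y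
      + t%:num * Phi (scaled_dist (1 - t%:num)%:i01 x y)
      + (1 - t%:num) * Phi (scaled_dist t x y)].

Definition set_lin_comb (R : realType) (V : lmodType R) (n : nat)
    (alpha : 'I_n -> R) (C : 'I_n -> set V) : set V :=
  [set \sum_(i < n) alpha i *: f i | f in [set f | forall i, C i (f i)]].

(* Main.v *)
Require Import Defs.
From HB Require Import structures.
From mathcomp Require Import all_boot all_order all_algebra.
From mathcomp Require Import all_classical all_reals all_analysis.
From mathcomp Require Import lra.

Import Order.TTheory GRing.Theory Num.Theory.
Import numFieldNormedType.Exports.

Local Open Scope classical_set_scope.
Local Open Scope ring_scope.

(** The inequality defining Phi-convexity is, for fixed points x, y and weight
    t, jointly linear in the pair (f, Phi): both sides are linear forms in the
    values of f and Phi. Hence the pairs (f, Phi) such that f is Phi-convex form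
    a convex cone: they contain (0, 0) and are stable under sums
    ([Phi_convexD]) and nonnegative scalings ([Phi_convexZ]). Nonnegative linear
    combinations of such pairs therefore stay in the cone ([Phi_convex_sum]).
    Convexity of the class of a single Phi is the case of two pairs with the same
    second component and weights l and 1 - l, because l Phi + (1 - l) Phi = Phi. *)

Lemma Phi_convex0 (R : realType) (I : openInterval R) :
  Phi_convex (0 : err_dom I -> R^o) 0.
Proof. by move=> x y t; rewrite !mulr0 !addr0. Qed.

Lemma Phi_convexD (R : realType) (I : openInterval R)
    (Phi Psi : err_dom I -> R^o) (f g : I -> R^o) :
  Phi_convex Phi f -> Phi_convex Psi g -> Phi_convex (Phi + Psi) (f + g).
Proof.
move=> fP gP x y t.
apply: le_trans (lerD (fP x y t) (gP x y t)) _.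
by rewrite !addrfctE; lra.
Qed.

Lemma Phi_convexZ (R : realType) (I : openInterval R)
    (Phi : err_dom I -> R^o) (f : I -> R^o) (a : R) :
  0 <= a -> Phi_convex Phi f -> Phi_convex (a *: Phi) (a *: f).
Proof.
move=> a0 fP x y t.
apply: le_trans (ler_wpM2l a0 (fP x y t)) _.
by rewrite !scalrfctE /GRing.scale /=; lra.
Qed.

Lemma Phi_convex_sum (R : realType) (I : openInterval R) (n : nat)
    (Phi : 'I_n -> (err_dom I -> R^o)) (alpha : 'I_n -> R)
    (f : 'I_n -> (I -> R^o)) :
  (forall i, 0 <= alpha i) -> (forall i, Phi_convex (Phi i) (f i)) ->
  Phi_convex (\sum_(i < n) alpha i *: Phi i) (\sum_(i < n) alpha i *: f i).
Proof.
move=> alpha0 fP.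
apply: (big_ind2 (fun Psi g => Phi_convex Psi g)).
- exact: Phi_convex0.
- by move=> Psi g Psi' g'; exact: Phi_convexD.
- by move=> i _; exact: Phi_convexZ.
Qed.

Lemma error_functions_sum (R : realType) (I : openInterval R) (n : nat)
    (Phi : 'I_n -> (err_dom I -> R^o)) (alpha : 'I_n -> R) :
  (forall i, 0 <= alpha i) -> (forall i, error_functions I (Phi i)) ->
  error_functions I (\sum_(i < n) alpha i *: Phi i).
Proof.
move=> alpha0 Phi0 u; rewrite fct_sumE.
by apply: sumr_ge0 => i _; exact: mulr_ge0 (alpha0 i) (Phi0 i u).
Qed.

Lemma convex_Phi_convex (R : realType) (I : openInterval R)
    (Phi : err_dom I -> R^o) : convex_set (Phi_convex Phi).
Proof.
move=> f g l /set_mem fP /set_mem gP; apply/mem_set.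
have l0 : 0 <= l%:num by [].
have l1 : 0 <= 1 - l%:num by rewrite subr_ge0.
have -> : Phi = l%:num *: Phi + (1 - l%:num) *: Phi.
  by rewrite -scalerDl addrC subrK scale1r.
exact: Phi_convexD (Phi_convexZ _ _ _ _ _ l0 fP) (Phi_convexZ _ _ _ _ _ l1 gP).
Qed.

Theorem proposition2p1 (R : realType) (I : openInterval R) :
  (forall (n : nat) (Phi : 'I_n -> (err_dom I -> R^o)) (alpha : 'I_n -> R),
     (forall i, Phi i \in error_functions I) ->
     (forall i, 0 <= alpha i) ->
     [/\ \sum_(i < n) alpha i *: Phi i \in error_functions I,
         set_lin_comb alpha (fun i => Phi_convex (Phi i))
           `<=` Phi_convex (\sum_(i < n) alpha i *: Phi i) &
         forall f : 'I_n -> (I -> R^o),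
           (forall i, f i \in Phi_convex (Phi i)) ->
           \sum_(i < n) alpha i *: f i
             \in Phi_convex (\sum_(i < n) alpha i *: Phi i)])
  /\
  (forall Phi : err_dom I -> R^o,
     Phi \in error_functions I -> convex_set (Phi_convex Phi)).
Proof.
split=> [n Phi alpha Phi0 alpha0|Phi _]; last exact: convex_Phi_convex.
split.
- by apply/mem_set/error_functions_sum => // i; exact: set_mem (Phi0 i).
- by move=> _ [f fP <-]; exact: Phi_convex_sum.
- by move=> f fP; apply/mem_set/Phi_convex_sum => // i; exact: set_mem (fP i).
Qed.
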